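(* Let $\{c_{j,k}\}$ be the array determined by the recurrence $$c_{j,k+1}=j^2c_{j,k}+j\,c_{j-1,k},\qquad k\geq 1,\; 1\leq j\leq k+1,$$ with $c_{0,k}=c_{k+1,k}=0$ for all $k\geq 1$ and $c_{1,1}=1$. Define $F_k(j)$ for integers $j\geq 1$, $k\geq 0$ by $c_{j,j+k}=F_k(j)\,j!$. Then $$F_k(j)-F_k(j-1)=j^2F_{k-1}(j),\qquad j\geq 2,\; k\geq 1,$$ with $F_0(j)=1$ for all $j\geq 1$ and $F_k(1)=1$ for all $k\geq 0$, and the solution is $$F_k(j)=1+\sum_{2\leq\lambda_1\leq j}\lambda_1^2+\sum_{2\leq\lambda_1\leq\lambda_2\leq j}\lambda_1^2\lambda_2^2+\cdots+\sum_{2\leq\lambda_1\leq\cdots\leq\lambda_k\leq j}\lambda_1^2\lambda_2^2\cdots\lambda_k^2 .$$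
   Context: The array $c_{j,k}$ is indexed by integers $k\geq 1$ and $0\leq j\leq k+1$, with boundary entries $c_{0,k}=c_{k+1,k}=0$. The sums defining $F_k(j)$ run over integers $\lambda_i$; an empty sum equals $0$, and for $k=0$ the formula reads $F_0(j)=1$. *)

(* Defs.v *)
From mathcomp Require Import all_boot all_order all_algebra.

Set Implicit Arguments.
Unset Strict Implicit.
Unset Printing Implicit Defensive.

Import Order.TTheory GRing.Theory Num.Theory.
Local Open Scope ring_scope.

(* [c j k] stands for c_{j,k}. Only the entries with 1 <= k and j <= k + 1 are
   constrained; the other values of the total function [c] are irrelevant. *)
Definition is_array (c : nat -> nat -> rat) : Prop :=
  [/\ forall k, (1 <= k)%N -> c 0%N k = 0,
      forall k, (1 <= k)%N -> c k.+1 k = 0,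
      c 1%N 1%N = 1 &
      forall j k, (1 <= k)%N -> (1 <= j <= k.+1)%N ->
        c j k.+1 = j%:R ^+ 2 * c j k + j%:R * c j.-1 k].

(* [F k j] stands for F_k(j). *)
Definition is_normalization (c F : nat -> nat -> rat) : Prop :=
  forall j k, (1 <= j)%N -> c j (j + k)%N = F k j * (j`!)%:R.

Definition solves_difference_eq (F : nat -> nat -> rat) : Prop :=
  [/\ forall j k, (2 <= j)%N -> (1 <= k)%N ->
        F k j - F k j.-1 = j%:R ^+ 2 * F k.-1 j,
      forall j, (1 <= j)%N -> F 0%N j = 1 &
      forall k, F k 1%N = 1].

(* The sum of the products of the squares l_1^2 ... l_m^2 over all
   2 <= l_1 <= ... <= l_m <= j. *)
Definition chain_sum (m j : nat) : rat :=
  \sum_(l : m.-tuple 'I_j.+1 |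
          all (leq 2) (map val l) && sorted leq (map val l))
     \prod_(i < m) (tnth l i)%:R ^+ 2.

Definition solution (k j : nat) : rat :=
  1 + \sum_(1 <= m < k.+1) chain_sum m j.

Fixpoint array_witness (k j : nat) {struct k} : rat :=
  if k is k'.+1 then
    if k' is 0%N then (j == 1%N)%:R
    else j%:R ^+ 2 * array_witness k' j + j%:R * array_witness k' j.-1
  else 0.

Lemma is_array_witness : is_array (fun j k => array_witness k j).
Proof.
have W k j : (k < j)%N -> array_witness k j = 0.
  elim: k j => [|[|k] IH] j // ltkj; first by rewrite /=; case: j ltkj => [|[]].
  rewrite /= in IH *; rewrite !IH ?mulr0 ?addr0 //; last exact: ltnW.
  by case: j ltkj.
split=> [[|[|k]] // _|k _||j [|k] // _ _] //=; last by rewrite W.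
by rewrite expr0n /= !mul0r addr0.
Qed.

(* Main.v *)
Require Import Defs.
From mathcomp Require Import all_boot all_order all_algebra.

Set Implicit Arguments.
Unset Strict Implicit.
Unset Printing Implicit Defensive.

Import Order.TTheory GRing.Theory Num.Theory.
Local Open Scope ring_scope.

(** In the recurrence for c_(j,j+k), divided by j!, the term j c_(j-1,j-1+k)
    becomes F_k(j-1) because j! = j * (j-1)!; this gives the difference
    equation ([normalization_difference_eq]).  The two boundary families come
    from iterating the recurrence along the diagonal, where it reads
    c_(j+1,j+1) = (j+1) c_(j,j), and along the row j = 1, where it reads
    c_(1,k+1) = c_(1,k).

    The difference equation determines F_k(j) by induction on k and then on j
    ([difference_eq_unique]), so it remains to see that the claimed sum solves
    it.  Its summands are the complete homogeneous symmetric functions h_m of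
    2^2, ..., j^2, and sorting the chains by whether their largest element is
    equal to j gives h_m(j) = h_m(j-1) + j^2 h_(m-1)(j) ([chain_sumS]).  Summing
    over m yields the difference equation ([solution_difference_eq]). *)

(** * From the array to the difference equation *)

Lemma array_diag c j : is_array c -> (1 <= j)%N -> c j j = (j`!)%:R.
Proof.
case=> _ ck1 c11 crec; elim: j => [//|[|j] IH] _; first by rewrite c11.
by rewrite crec ?leqnn // ck1 // mulr0 add0r /= IH // -natrM -factS.
Qed.

Lemma array_row1 c k : is_array c -> c 1%N k.+1 = 1.
Proof.
case=> c0 _ c11 crec; elim: k => [//|k IH].
by rewrite crec //= c0 // IH expr1n mulr0 mulr1 addr0.
Qed.

Lemma normalization_difference_eq c F :
  is_array c -> is_normalization c F -> solves_difference_eq F.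
Proof.
move=> hc hF; have fact_neq0 n : (n`!)%:R != 0 :> rat.
  by rewrite pnatr_eq0 -lt0n fact_gt0.
split=> [[|[|j]] // [|k] // _ _|j j1|k].
- have [_ _ _ crec] := hc.
  apply: (mulIf (fact_neq0 j.+2)); rewrite mulrBl -hF // addnS crec //; last first.
    by rewrite /= leqW ?leq_addr.
  rewrite hF //= addSnnS hF // [_%:R * (F k.+1 _ * _)]mulrCA -natrM -factS.
  by rewrite addrK mulrA.
- by apply: (mulIf (fact_neq0 j)); rewrite -hF // addn0 array_diag // mul1r.
- by have := hF 1%N k isT; rewrite add1n array_row1 // mulr1.
Qed.

Lemma difference_eq_unique F G :
  solves_difference_eq F -> solves_difference_eq G ->
  forall k j, (1 <= j)%N -> F k j = G k j.
Proof.
move=> [Frec F0 F1] [Grec G0 G1]; elim=> [|k IHk] j j1; first by rewrite F0 ?G0.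
elim: j j1 => [//|[|j] IHj] _; first by rewrite F1 G1.
apply: (addIr (- F k.+1 j.+1)); rewrite Frec // IHj // Grec //=.
by rewrite IHk.
Qed.

(** * Sums over chains *)

Definition chain (s : seq nat) := all (leq 2) s && sorted leq s.

(** Comparing the last entry with every other one, and not just with its
    neighbour, exhibits it as the largest, which bounds the whole chain. *)
Lemma chain_rcons s x :
  chain (rcons s x) = [&& (2 <= x)%N, all (leq^~ x) s & chain s].
Proof.
rewrite /chain !(sorted_pairwise leq_trans) pairwise_rcons all_rcons.
by rewrite -!andbA; congr (_ && _); rewrite andbCA.
Qed.

Lemma chain_sumE m j :
  chain_sum m j = \sum_(l : m.-tuple 'I_j.+1 | chain (map val l))
                    \prod_(x <- l) (x : nat)%:R ^+ 2.
Proof. by apply: eq_bigr => l _; rewrite big_tuple. Qed.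

Lemma chain_sum0 j : chain_sum 0 j = 1.
Proof.
rewrite chain_sumE (big_pred1 [tuple]) => [|l]; first by rewrite big_nil.
by rewrite [l]tuple0; apply/esym/eqP.
Qed.

Lemma chain_sum1 m : chain_sum m.+1 1 = 0.
Proof.
rewrite chain_sumE big_pred0 // => l; case/tupleP: l => x l.
by rewrite /chain /= [(1 < x)%N]ltnNge -ltnS ltn_ord.
Qed.

(** Removing the last entry j from a chain ending in j leaves an arbitrary
    shorter chain bounded by j. *)
Lemma chain_sum_last m j : (2 <= j)%N ->
  \sum_(l : m.+1.-tuple 'I_j.+1 |
         chain (map val l) && (last ord_max l == ord_max))
     \prod_(x <- l) (x : nat)%:R ^+ 2 = j%:R ^+ 2 * chain_sum m j.
Proof.
move=> j2; rewrite chain_sumE mulr_sumr.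
(* [ord_max : 'I_j.+1] has value j; it is the entry that is added or removed. *)
rewrite (reindex_onto (fun t : m.-tuple 'I_j.+1 => [tuple of rcons t ord_max])
  (fun t => [tuple of belast (thead t) (behead t)])) /=; last first.
  move=> l; case/tupleP: l => x l /= /andP[_ /eqP last_l].
  by apply: val_inj; rewrite /= theadE -[in LHS]last_l -lastI.
apply: eq_big => [t|t _]; last by rewrite big_rcons /= mulrC.
rewrite last_rcons eqxx andbT map_rcons chain_rcons j2 /=.
have -> : all (leq^~ j) (map val t).
  by apply/allP => _ /mapP[x _ ->]; rewrite -ltnS ltn_ord.
rewrite /= -[RHS]andbT; congr (_ && _); apply/eqP/val_inj => /=.
case: t => -[|y s] ?; first by [].
by rewrite /thead /= (tnth_nth y) /= belast_rcons.
Qed.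

(** As the last entry of a chain is its largest one, a chain that does not end
    in the bound is bounded by its predecessor. *)
Lemma chain_sum_not_last m j :
  \sum_(l : m.+1.-tuple 'I_j.+2 |
         chain (map val l) && (last ord_max l != ord_max))
     \prod_(x <- l) (x : nat)%:R ^+ 2 = chain_sum m.+1 j.
Proof.
rewrite chain_sumE.
(* [inord] inverts the widening only on entries below j.+1, so every chain of
   the sum is reached because its entries are at most its last one. *)
rewrite (reindex_onto (map_tuple (widen_ord (leqnSn j.+1)))
  (map_tuple (fun x : 'I_j.+2 => inord x))) /=; last first.
  move=> l /andP[cl last_l]; apply: val_inj; rewrite /= -map_comp.
  apply: map_id_in => x xl; apply: val_inj; rewrite /= inordK //.
  case/tupleP: l cl last_l xl => y l; rewrite /= -(map_cons val y l) lastI.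
  rewrite map_rcons chain_rcons => /and3P[_ /allP le_last _] last_l xl.
  have {}last_l : (last y l < j.+1)%N.
    by rewrite ltn_neqAle -ltnS ltn_ord andbT.
  move: xl; rewrite mem_rcons in_cons; case/predU1P => [->//|{}xl].
  by apply: leq_ltn_trans last_l; apply/le_last/map_f.
apply: eq_big => [t|t _]; last by rewrite big_map.
rewrite -map_comp (eq_map (_ : _ =1 val)) //.
rewrite -[RHS]andbT -andbA; congr (_ && _); apply/andP; split.
  case/tupleP: t => x t; rewrite /= last_map.
  by rewrite -val_eqE /= neq_ltn ltn_ord.
apply/eqP/val_inj; rewrite /= -map_comp; apply: map_id_in => x _.
by apply: val_inj; rewrite /= inordK.
Qed.

(** The recurrence h_m(x_1, ..., x_n) = h_m(x_1, ..., x_(n-1)) +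
    x_n h_(m-1)(x_1, ..., x_n) of the complete homogeneous symmetric
    functions. *)
Lemma chain_sumS m j : (1 <= j)%N ->
  chain_sum m.+1 j.+1 = chain_sum m.+1 j + j.+1%:R ^+ 2 * chain_sum m j.+1.
Proof.
move=> j1; rewrite chain_sumE (bigID (fun l => last ord_max (val l) == ord_max)).
by rewrite chain_sum_last // chain_sum_not_last addrC.
Qed.

Lemma solutionE k j : solution k j = \sum_(m < k.+1) chain_sum m j.
Proof.
rewrite /solution -(big_mkord xpredT (chain_sum^~ j)).
by rewrite [RHS]big_ltn // chain_sum0.
Qed.

Lemma solution_difference_eq : solves_difference_eq solution.
Proof.
split=> [[|[|j]] // [|k] // _ _|j _|k].
- rewrite !solutionE !(big_ord_recl k.+1) /= !chain_sum0 /bump /=.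
  rewrite opprD addrACA subrr add0r -sumrB mulr_sumr.
  by apply: eq_bigr => m _; rewrite add1n chain_sumS // [_ + _ * _]addrC addrK.
- by rewrite solutionE big_ord1 chain_sum0.
- rewrite solutionE big_ord_recl chain_sum0 big1 ?addr0 // => m _.
  exact: chain_sum1.
Qed.

Theorem mainTheorem2 (c F : nat -> nat -> rat)
  (hc : is_array c) (hF : is_normalization c F) :
  [/\ solves_difference_eq F,
      forall k j, (1 <= j)%N -> F k j = solution k j &
      forall G, solves_difference_eq G ->
        forall k j, (1 <= j)%N -> G k j = solution k j].
Proof.
have solF := normalization_difference_eq hc hF.
have uniq G solG := @difference_eq_unique G _ solG solution_difference_eq.
by split=> //; apply: uniq.
Qed.
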